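(* Let $n=\prod_p p^{v_p}$ be a positive integer such that (i) $v_p\le 2$ for all primes $p\mid n$; (ii) $p\nmid (q^{v_q}-1)$ for all primes $p,q$ dividing $n$; (iii) $4\nmid n$. Then a cyclic Galois field extension of degree $n$ admits exactly $n/r(n)$ Hopf-Galois structures, all of which are of cyclic type, where $r(n)=\prod_{p\mid n}p$.
   Context: Hopf-Galois structures on a Galois extension $L/K$ with group $\Gamma$ correspond (Greither–Pareigis) to regular subgroups $G$ of $\mathrm{Perm}(\Gamma)$ normalized by the left regular representation $\lambda(\Gamma)$; the type of the structure is the isomorphism class of $G$. Equivalently, the number of structures of type $G$ is the number of $\mathrm{Aut}(G)$-conjugacy classes of injective homomorphisms $\Gamma\to\mathrm{Hol}(G)=\rho(G)\cdot\mathrm{Aut}(G)$ with regular image. *)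

(* Defs.v *)
From mathcomp Require Import all_boot all_fingroup all_solvable.
Set Implicit Arguments. Unset Strict Implicit. Unset Printing Implicit Defensive.
Local Open Scope group_scope.

Definition lambda_perm (gT : finGroupType) (g : gT) : {perm gT} :=
  perm (mulgI g).

Definition lambda_img (gT : finGroupType) : {set {perm gT}} :=
  [set lambda_perm g | g : gT].

Definition regular_perm (gT : finGroupType) (G : {set {perm gT}}) : bool :=
  [transitive G, on [set: gT] | 'P] && [forall x : gT, 'C_G[x | 'P] == 1].

(* Regular subgroups of Perm(Gamma) normalized by lambda(Gamma); by
   Greither--Pareigis these are in bijection with the Hopf-Galois structures
   on a Galois extension with group Gamma. *)
Definition HGS (gT : finGroupType) : {set {group {perm gT}}} :=
  [set G : {group {perm gT}} | regular_perm G && (lambda_img gT \subset 'N(G))].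

Definition rad (n : nat) : nat := \prod_(p <- primes n) p.

(* Main.v *)
Require Import Defs.
From mathcomp Require Import all_boot all_fingroup all_solvable.
From mathcomp Require Import ssralg.

(* Under (i) and (ii) every Sylow subgroup S of a group G of order n is abelian
   and central in its normaliser, so the transfer G -> S shows that S meets the
   derived subgroup trivially; hence G is abelian.

   If G is moreover a regular permutation group normalised by a regular cyclic
   group C, let P and <t> be Sylow p-subgroups of G and C. Some orbit of the
   p-group P<t> is no larger than a P-orbit, so t x = u x for some point x and
   some u in P. If P were elementary abelian of order p^2, with p odd by (iii),
   then w = t u^-1 would satisfy (w u)^p = w^p, so t^p would fix x although t
   has order p^2. So G is cyclic.

   For the count, let s generate the regular cyclic group lambda(Gamma). A
   cyclic G normalised by s contains a unique h with h 1 = s 1, and w = h s^-1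
   fixes 1. If s^w = s^(1+d) with n | d^2, then s and w generate a group of
   class two, in which h^m = w^m s^(m + d C(m,2)). For odd n this shows that
   <w s> is regular and that h^d = s^d, so that the roles of s and h can be
   exchanged (an even n must be 2). Thus the groups G correspond to the
   residues d modulo n divisible by rad n. *)

Set Implicit Arguments.
Unset Strict Implicit.
Unset Printing Implicit Defensive.

Section RadicalArithmetic.

Lemma rad_dvd n m : (forall p, p \in primes n -> p %| m) -> rad n %| m.
Proof.
rewrite /rad; have := primes_uniq n; have := all_prime_primes n.
elim: (primes n) => [|q s IHs] /=; first by rewrite big_nil dvd1n.
case/andP=> q_pr s_pr /andP[q_s uniq_s] dvd_m; rewrite big_cons Gauss_dvd.
  rewrite dvd_m ?mem_head // IHs // => p p_s.
  by rewrite dvd_m // inE p_s orbT.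
rewrite prime_coprime // Euclid_dvd_prod // big_has; apply/hasPn => p p_s.
rewrite (dvdn_prime2 q_pr (allP s_pr p p_s)).
by apply: contraNneq q_s => ->.
Qed.

Lemma rad_dvdn n : rad n %| n.
Proof. by apply: rad_dvd => p; rewrite mem_primes => /and3P[]. Qed.

Lemma primes_dvd_rad n p : p \in primes n -> p %| rad n.
Proof. by move=> p_n; rewrite /rad (big_rem p) //= dvdn_mulr. Qed.

Lemma dvdn_rad_sqr n : (forall p, logn p n <= 2) -> 0 < n -> n %| rad n ^ 2.
Proof.
move=> le2 n_gt0; apply/dvdn_partP => // p p_n; rewrite p_part.
by rewrite (dvdn_trans (dvdn_exp2l p (le2 p))) // dvdn_exp2r ?primes_dvd_rad.
Qed.

Lemma odd_or_rad_id n :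
    (forall p q, p \in primes n -> q \in primes n ->
      ~~ (p %| q ^ logn q n - 1)) ->
    ~~ (4 %| n) -> 0 < n ->
  odd n \/ rad n = n.
Proof.
move=> ndvd n4 n_gt0; have [|even_n] := boolP (odd n); [by left | right].
have two_n : 2 \in primes n by rewrite mem_primes n_gt0 dvdn2 even_n.
have n2 : 2.-nat n.
  apply/pnatP => // q q_pr q_n; rewrite inE /=.
  have q_in : q \in primes n by rewrite mem_primes q_pr n_gt0.
  case: (even_prime q_pr) => [->//|odd_q]; have := ndvd _ _ two_n q_in.
  by rewrite dvdn2 oddB ?expn_gt0 ?prime_gt0 // oddX odd_q orbT.
have log1 : logn 2 n = 1.
  apply/eqP; rewrite eqn_leq logn_gt0 two_n andbT leqNgt.
  by apply: contra n4 => lt1; rewrite -[4]/(2 ^ 2) pfactor_dvdn.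
have -> : n = 2 by rewrite -(part_pnat_id n2) p_part log1.
by rewrite /rad big_seq1.
Qed.

Variables n d : nat.
Hypothesis dvd_d2 : n %| d ^ 2.

Lemma coprime_addn_mul u m : coprime n u -> coprime n (u + m * d).
Proof.
move=> co_nu; pose q := gcdn n (u + m * d).
have co_qu : coprime q u by apply: coprime_dvdl co_nu; apply: dvdn_gcdl.
have co_qd : coprime q d.
  have e_md : gcdn q d %| m * d by rewrite dvdn_mull ?dvdn_gcdr.
  rewrite /coprime -dvdn1 -(eqP co_qu) dvdn_gcd dvdn_gcdl -(dvdn_addl u e_md).
  by rewrite (dvdn_trans (dvdn_gcdl _ _)) ?dvdn_gcdr.
have : coprime q (d ^ 2) by rewrite coprimeXr.
by rewrite /coprime (gcdn_idPl _) // (dvdn_trans (dvdn_gcdl _ _)).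
Qed.

Hypothesis odd_or_dvd : odd n \/ n %| d.

Lemma dvdn_addn_mul_bin2 m : (n %| m + d * 'C(m, 2)) = (n %| m).
Proof.
case: odd_or_dvd => [odd_n | dvd_d]; last by rewrite dvdn_addl // dvdn_mulr.
have co_n2 : coprime n 2 by rewrite coprimen2.
rewrite -(Gauss_dvdr _ co_n2) mulnDr mulnCA -mul_bin_diag bin1 mulnCA.
by rewrite (mulnC 2) -mulnDr Gauss_dvdl // mulnC coprime_addn_mul.
Qed.

Lemma dvdn_mul_bin2 : n %| d * 'C(d, 2).
Proof.
case: odd_or_dvd => [odd_n | dvd_d]; last by rewrite dvdn_mulr.
rewrite -(@Gauss_dvdr _ 2) ?coprimen2 // mulnCA -mul_bin_diag bin1 mulnA.
by rewrite dvdn_mulr.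
Qed.

End RadicalArithmetic.

Local Open Scope group_scope.

Lemma transfer_der1 (gT aT : finGroupType) (G H : {group gT})
    (alpha : {morphism H >-> aT}) (abelA : abelian (alpha @* H)) x :
  x \in G^`(1) -> transfer G abelA x = 0%R.
Proof.
move=> G'x; pose V := transfer_morphism G abelA.
have abelV : abelian (V @* G).
  by apply/centsP => a _ b _; exact: GRing.addrC.
apply/set1gP; rewrite -[[1]](derG1P abelV) -morphim_der //.
exact: mem_morphim (subsetP (der_sub 1 G) x G'x) G'x.
Qed.

Section BurnsideTransfer.

Variables (gT : finGroupType) (p : nat) (G S : {group gT}).
Hypotheses (sylS : p.-Sylow(G) S) (abelS : abelian S).

Let sSG : S \subset G := pHall_sub sylS.

(* S and its conjugate by u^-1 are both Sylow subgroups of 'C_G[y]. *)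
Lemma abelian_Sylow_fusion y u :
    u \in G -> y \in S -> y ^ u \in S ->
  exists2 v, v \in 'N_G(S) & y ^ v = y ^ u.
Proof.
move=> Gu Sy Syu; pose Su := (S :^ u^-1)%G.
have Sylow_cent1 (Q : {group gT}) :
    p.-Sylow(G) Q -> abelian Q -> y \in Q -> p.-Sylow('C_G[y]) Q.
  move=> sylQ abelQ Qy; apply: (pHall_subl _ (subsetIl _ _) sylQ).
  by rewrite subsetI (pHall_sub sylQ) sub_cent1 (subsetP abelQ).
have sylCS := Sylow_cent1 S sylS abelS Sy.
have sylCSu : p.-Sylow('C_G[y]) Su.
  by apply: Sylow_cent1; rewrite ?pHallJ ?groupV ?abelianJ ?mem_conjgV.
have [c /setIP[Gc cyc] defSu] := Sylow_trans sylCS sylCSu.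
exists (c * u); last by rewrite conjgM /(y ^ c) -(cent1P cyc) mulKg.
rewrite inE groupM //; apply/normP.
by rewrite conjsgM -defSu conjsgKV.
Qed.

Hypothesis cSN : 'N_G(S) \subset 'C(S).

Lemma conjg_central_Sylow y u : u \in G -> y \in S -> y ^ u \in S -> y ^ u = y.
Proof.
move=> Gu Sy Syu; have [v Nv <-] := abelian_Sylow_fusion Gu Sy Syu.
by rewrite conjgE -(centP (subsetP cSN v Nv)) ?mulKg.
Qed.

Lemma transfer_central_Sylow (abelA : abelian (idm S @* S)) g :
  g \in S -> transfer G abelA g = (FiniteModule.fmod abelA g *+ #|G : S|)%R.
Proof.
move=> Sg; have Gg := subsetP sSG g Sg.
have trX := transversalP (rcosets_cycle_partition sSG Gg).
set X := transversal _ _ in trX.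
rewrite (transfer_cycle_expansion sSG abelA Gg trX).
rewrite -(sum_index_rcosets_cycle sSG Gg trX) -GRing.sumrMnr.
apply: eq_bigr => x Xx; have Gx := subsetP (transversal_sub trX) x Xx.
have Sgx : (g ^+ #|<[g]> : S :* x|) ^ x^-1 \in S.
  have := mulg_exp_card_rcosets S g x; rewrite mem_rcoset.
  by rewrite conjgE invgK mulgA.
rewrite /restrm /= /idm conjg_central_Sylow ?groupV ?groupX //.
by rewrite FiniteModule.fmodX /= ?morphim_idm.
Qed.

Lemma der1_central_Sylow_TI : S :&: G^`(1) = 1.
Proof.
have abelA : abelian (idm S @* S) by rewrite morphim_idm.
apply/trivgP/subsetP => g /setIP[Sg /(transfer_der1 abelA)].
rewrite transfer_central_Sylow // => /(congr1 val).
rewrite FiniteModule.fmvalZ FiniteModule.fmval0.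
rewrite FiniteModule.fmodK /= ?morphim_idm //.
move=> gi1; have /andP[_ coSi] := pHall_Hall sylS.
by rewrite -(expgK coSi Sg) gi1 expg1n inE.
Qed.

End BurnsideTransfer.

Lemma abelian_central_Sylows (gT : finGroupType) (G : {group gT}) :
    (forall p (S : {group gT}), p.-Sylow(G) S ->
      abelian S /\ 'N_G(S) \subset 'C(S)) ->
  abelian G.
Proof.
move=> centralS; apply/derG1P/trivgP.
rewrite -(Sylow_gen G^`(1)) gen_subG; apply/bigcupsP => P /SylowP[p _ sylP].
have sPG := subset_trans (pHall_sub sylP) (der_sub 1 G).
have [S sylS sPS] := Sylow_superset sPG (pHall_pgroup sylP).
have [abelS cSN] := centralS p S sylS.
rewrite /= -(der1_central_Sylow_TI sylS abelS cSN) subsetI sPS.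
exact: pHall_sub sylP.
Qed.

(* The numbers q ^ i - q ^ j are the factors of the order of GL_i(q). *)
Lemma norm_cent_pgroup (gT : finGroupType) (A Q : {group gT}) q i :
    prime q -> #|Q| = (q ^ i)%N -> A \subset 'N(Q) ->
    (forall p j, p \in \pi(A) -> (j < i)%N -> ~~ (p %| q ^ i - q ^ j)) ->
  A \subset 'C(Q).
Proof.
move=> q_pr oQ nQA ndvd; rewrite -(Sylow_gen A) gen_subG.
apply/bigcupsP => P /SylowP[p p_pr sylP].
have [sPA pP] := (pHall_sub sylP, pHall_pgroup sylP).
have [->|ntP] := eqsVneq P 1; first exact: sub1G.
have [_ p_dvd _] := pgroup_pdiv pP ntP.
have piAp : p \in \pi(A).
  by rewrite mem_primes p_pr cardG_gt0 (dvdn_trans p_dvd) ?cardSg.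
have [j le_ji oC] : exists2 j, (j <= i)%N & #|'C_Q(P)| = (q ^ j)%N.
  by apply/(dvdn_pfactor _ _ q_pr); rewrite -oQ cardSg ?subsetIl.
have := pgroup_fix_mod (to := 'J) pP (_ : [acts P, on Q | 'J]).
rewrite astabsJ => /(_ (subset_trans sPA nQA))/eqP.
rewrite afixJ eqn_mod_dvd ?subset_leq_card ?subsetIl // oQ oC.
move: le_ji; rewrite leq_eqVlt => /predU1P[eq_ji _ | lt_ji].
  rewrite centsC; apply/setIidPl/eqP.
  by rewrite eqEcard subsetIl oQ oC eq_ji /=.
by rewrite (negPf (ndvd p j piAp lt_ji)).
Qed.

Section AbelianOrder.

Variables (gT : finGroupType) (G : {group gT}).
Local Notation n := #|G|.
Hypothesis logn_le2 : forall p, (logn p n <= 2)%N.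
Hypothesis ndvd_part_pred : forall p q, p \in primes n -> q \in primes n ->
  ~~ (p %| q ^ logn q n - 1).

Lemma ndvd_part_sub p q j :
    p \in primes n -> q \in primes n -> p != q -> (j < logn q n)%N ->
  ~~ (p %| q ^ logn q n - q ^ j).
Proof.
move=> pn qn neq_pq ltj; have := ndvd_part_pred pn qn; have le2 := logn_le2 q.
move: pn qn; rewrite !mem_primes => /andP[p_pr _] /andP[q_pr _].
case: j ltj => [|j] ltj; first by rewrite expn0.
have {le2 ltj} [-> ->] : logn q n = 2 /\ j = 0.
  by case: (logn q n) le2 ltj => [|[|[|m]]] //; case: j.
have -> : (q ^ 2 - q ^ 1 = q * (q - 1))%N by rewrite mulnBr muln1.
rewrite Euclid_dvdM // (dvdn_prime2 p_pr q_pr) (negPf neq_pq) /=.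
by apply: contra => dvdp; rewrite -(exp1n 2) subn_sqr dvdn_mulr.
Qed.

Lemma central_Sylow_norm p (S : {group gT}) :
  p.-Sylow(G) S -> abelian S -> 'N_G(S) \subset 'C(S).
Proof.
move=> sylS abelS; have [sSG pS _] := and3P sylS.
have [->|ntS] := eqsVneq S 1; first by rewrite cents1.
have [p_pr p_dvd _] := pgroup_pdiv pS ntS.
have pn : p \in primes n.
  by rewrite mem_primes p_pr cardG_gt0 (dvdn_trans p_dvd) ?cardSg.
have sylSN : p.-Sylow('N_G(S)) S by rewrite Sylow_subnorm.
have nsSN : S <| 'N_G(S) by rewrite normalSG.
have /splitsP[K /complP[tiSK defN]] :=
  SchurZassenhaus_split (pHall_Hall sylSN) nsSN.
have /subsetIP[sKG nSK] : K \subset 'N_G(S) by rewrite -defN mulG_subr.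
have p'K : p^'.-group K.
  have [_ _] := and3P sylSN.
  by rewrite -divgS ?normal_sub // -defN TI_cardMg // mulKn.
have oS : #|S| = (p ^ logn p n)%N by rewrite (card_Hall sylS) p_part.
rewrite -defN mul_subG //; apply: (norm_cent_pgroup p_pr oS nSK) => q j piKq.
apply: ndvd_part_sub => //; last exact: (pnatPpi p'K).
by apply: (pi_of_dvd _ _ piKq); rewrite ?cardSg.
Qed.

Lemma abelian_of_order : abelian G.
Proof.
apply: abelian_central_Sylows => p S sylS.
suff abelS : abelian S by split; last exact: central_Sylow_norm sylS abelS.
apply: (p2group_abelian (pHall_pgroup sylS)).
by rewrite (card_Hall sylS) logn_part.
Qed.

End AbelianOrder.

Section RegularPerm.

Variable gT : finGroupType.
Implicit Types (G H : {group {perm gT}}) (g h s w : {perm gT}) (x y : gT).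

Lemma regular_trans G x y : regular_perm G -> exists2 g, g \in G & g x = y.
Proof.
case/andP=> /atransP/(_ x (in_setT x)) orbGx _.
by have /orbitP : y \in orbit 'P G x by rewrite orbGx inE.
Qed.

Lemma regular_fix1 G g x : regular_perm G -> g \in G -> g x = x -> g = 1.
Proof.
case/andP=> _ /forallP/(_ x)/eqP stab1 Gg gx.
by apply/set1gP; rewrite -stab1 inE Gg; apply/astab1P.
Qed.

Lemma regular_inj G g h x :
  regular_perm G -> g \in G -> h \in G -> g x = h x -> g = h.
Proof.
move=> regG Gg Gh eq_gh; apply/eqP; rewrite eq_mulgV1; apply/eqP.
apply: (regular_fix1 (x := x) regG); first by rewrite groupM ?groupV.
by rewrite permM eq_gh permK.
Qed.

Lemma regular_cent_fix1 G w x :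
  regular_perm G -> w \in 'C(G) -> w x = x -> w = 1.
Proof.
move=> regG /centP cGw wx; apply/permP => y; rewrite perm1.
have [g /cGw cwg <-] := regular_trans x y regG.
by rewrite -permM -cwg permM wx.
Qed.

Lemma regular_cycle_conj_inj s w w' x :
    regular_perm <[s]> -> w x = x -> w' x = x -> s ^ w = s ^ w' ->
  w = w'.
Proof.
move=> reg_s wx w'x eq_sw; apply/eqP; rewrite eq_mulgV1; apply/eqP.
apply: (regular_cent_fix1 (x := x) reg_s); last first.
  by rewrite permM wx -{1}w'x permK.
rewrite cent_cycle; apply/cent1P/commute_sym/commgP/conjg_fixP.
by rewrite conjgM eq_sw conjgK.
Qed.

Lemma card_orbit_regular G H x :
  regular_perm G -> H \subset G -> #|orbit 'P H x| = #|H|.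
Proof.
move=> regG sHG; rewrite card_orbit (_ : 'C_H[x | 'P] = 1) ?indexg1 //.
apply/trivgP/subsetP => h /setIP[/(subsetP sHG) Gh /astab1P hx].
exact/set1P/(regular_fix1 regG Gh hx).
Qed.

Lemma card_regular G : regular_perm G -> #|G| = #|gT|.
Proof.
move=> regG; have /andP[/atransP trG _] := regG.
by rewrite -(card_orbit_regular 1 regG (subxx G)) trG ?inE ?cardsT.
Qed.

Lemma card_fix1_regular G x :
    #|G| = #|gT| -> (forall g, g \in G -> g x = x -> g = 1) ->
  regular_perm G.
Proof.
move=> oG freeG.
have orb_stab y : #|orbit 'P G y| = #|G : 'C_G[y | 'P]| := card_orbit 'P G y.
have stab1 : 'C_G[x | 'P] = 1.
  apply/trivgP/subsetP => g /setIP[Gg /astab1P gx].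
  exact/set1P/freeG.
have orbGx : orbit 'P G x = [set: gT].
  by apply/eqP; rewrite eqEcard subsetT cardsT orb_stab stab1 indexg1 oG /=.
have trG : [transitive G, on [set: gT] | 'P].
  by apply/imsetP; exists x; rewrite ?inE ?orbGx.
apply/andP; split=> //; apply/forallP => y; rewrite trivg_card1.
have := Lagrange (subsetIl G 'C[y | 'P]).
rewrite -orb_stab (atransP trG) ?inE // cardsT -oG => /eqP.
by rewrite -[X in _ == X]mul1n eqn_pmul2r ?cardG_gt0.
Qed.

(* The orbit of y under H is stable under s, hence contains all points. *)
Lemma regular_norm_sub_eq G H s y :
    regular_perm G -> regular_perm <[s]> -> H \subset G -> s \in 'N(H) ->
    s y \in orbit 'P H y ->
  H :=: G.
Proof.
move=> regG reg_s sHG nHs orb_sy.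
have orb_sX i : (s ^+ i) y \in orbit 'P H y.
  elim: i => [|i /orbitP[h Hh def_h]]; first by rewrite perm1 orbit_refl.
  rewrite expgSr permM -def_h -permM conjgC permM.
  have Hhs : h ^ s \in H by rewrite memJ_norm.
  exact: orbit_trans (mem_orbit 'P (s y) Hhs) orb_sy.
apply/eqP; rewrite eqEcard sHG -(card_orbit_regular y regG sHG).
rewrite (card_regular regG) -[X in X <= _]cardsT subset_leq_card //.
apply/subsetP => z _.
by have [_ /cycleP[i ->] <-] := regular_trans y z reg_s.
Qed.

End RegularPerm.

Section PGroups.

Variables (gT : finGroupType) (p : nat).
Hypothesis p_pr : prime p.
Implicit Types P Q : {group gT}.

Lemma pgroup_orbit_dvd_part (rT : finType) (D : {group gT}) (to : action D rT)
    Q (S : {set rT}) :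
    p.-group Q -> [acts Q, on S | to] -> S != set0 ->
  exists2 x, x \in S & #|orbit to Q x| %| #|S|`_p.
Proof.
move=> pQ actsQ ntS.
apply/exists_inP; apply: contraTT isT => /exists_inPn ndvd.
suff: p ^ (logn p #|S|).+1 %| #|S| by rewrite pfactor_dvdn ?card_gt0 // ltnn.
rewrite -[X in _ %| X](acts_sum_card_orbit actsQ).
apply: dvdn_sum => _ /imsetP[x Sx ->]; have := ndvd x Sx.
have [k ->] : {k | #|orbit to Q x| = (p ^ k)%N}.
  apply: p_natP; apply: pnat_dvd pQ.
  by rewrite card_orbit_in ?dvdn_indexg // (acts_dom actsQ).
by rewrite p_part !dvdn_Pexp2l ?prime_gt1 // ltnNge.
Qed.

Lemma logn_comm_pgroup P Q :
  p.-group Q -> P <| Q -> (logn p #|[~: P, Q]| <= (logn p #|P|).-1)%N.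
Proof.
move=> pQ /andP[sPQ nPQ].
have [->|ntP] := eqsVneq P 1; first by rewrite comm1G cards1 logn1.
have prP : [~: P, Q] \proper P.
  by apply: nil_comm_properl (pgroup_nil pQ) _ _ _; rewrite // subsetI subxx.
have : (p ^ logn p #|[~: P, Q]| < p ^ logn p #|P|)%N.
  have pP := pgroupS sPQ pQ.
  by rewrite -!card_pgroup ?proper_card // (pgroupS (proper_sub prP)).
by rewrite ltn_exp2l ?prime_gt1 //; case: (logn p #|P|).
Qed.

Lemma comm2_pgroup_rank2 P Q :
  p.-group Q -> P <| Q -> (logn p #|P| <= 2)%N -> [~: P, Q, Q] = 1.
Proof.
move=> pQ nsPQ le2.
have sPQ_P : [~: P, Q] \subset P by rewrite commg_subl normal_norm.
have nsPQQ : [~: P, Q] <| Q.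
  by rewrite /normal commg_normr (subset_trans sPQ_P) ?normal_sub.
have pPQQ : p.-group [~: P, Q, Q].
  by rewrite (pgroupS _ pQ) // commg_subr normsG ?normal_sub.
apply: card1_trivg; rewrite (card_pgroup pPQQ); apply/eqP.
suff : (logn p #|[~: P, Q, Q]| <= 0)%N by rewrite leqn0 => /eqP->.
rewrite (leq_trans (logn_comm_pgroup pQ nsPQQ)) // -subn1 leq_subLR.
by rewrite (leq_trans (logn_comm_pgroup pQ nsPQ)) // -subn1 leq_subLR.
Qed.

(* The correction term [~ u, w] ^+ 'C(p, 2) vanishes because p is odd. *)
Lemma expMg_abelem_rank2 P Q w u :
    odd p -> p.-group Q -> P <| Q -> p.-abelem P -> (logn p #|P| <= 2)%N ->
    w \in Q -> u \in P ->
  (w * u) ^+ p = w ^+ p.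
Proof.
move=> odd_p pQ nsPQ abelP le2 Qw Pu; have [cPP expP] := abelemP p_pr abelP.
pose z := [~ u, w]; have PQz : z \in [~: P, Q] by rewrite mem_commg.
have Pz : z \in P by apply: subsetP PQz; rewrite commg_subl normal_norm.
have cQz : z \in 'C(Q).
  by apply: subsetP PQz; apply/commG1P/comm2_pgroup_rank2.
rewrite expMg_Rmul; last first.
- exact/commute_sym/(centP cQz).
- exact: (centsP cPP).
have /dvdnP[k ->] : p %| 'C(p, 2) by rewrite prime_dvd_bin //= odd_prime_gt2.
by rewrite mulnC expgM (expP u Pu) (expP z Pz) expg1n !mulg1.
Qed.

Lemma noncyclic_card_p2_abelem P :
  #|P| = (p ^ 2)%N -> ~~ cyclic P -> p.-abelem P.
Proof.
move=> oP ncycP; apply/abelemP; rewrite ?(card_p2group_abelian p_pr) //.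
split=> // u Pu; apply/eqP; rewrite -order_dvdn.
have : #[u] %| p ^ 2 by rewrite -oP order_dvdG.
case/(dvdn_pfactor _ _ p_pr) => -[|[|[|//]]] _ ou; rewrite ou ?dvd1n ?dvdnn //.
case/negP: ncycP; apply/cyclicP; exists u; apply/eqP.
by rewrite eq_sym eqEcard cycle_subG Pu oP -ou /=.
Qed.

End PGroups.

Section CyclicSylow.

Variables (gT : finGroupType) (p : nat) (G C P : {group {perm gT}}).
Hypotheses (p_pr : prime p) (regG : regular_perm G) (sylP : p.-Sylow(G) P).

Lemma regular_Sylow_orbit (Q : {group {perm gT}}) :
  p.-group Q -> P \subset Q -> exists x, orbit 'P Q x = orbit 'P P x.
Proof.
move=> pQ sPQ.
have [||x _ orbQ] := @pgroup_orbit_dvd_part _ _ p_pr _ _ 'P Q [set: gT] pQ.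
- by apply/actsP => a _ y; rewrite !inE.
- by apply/set0Pn; exists 1; rewrite inE.
exists x; apply/esym/eqP; rewrite eqEcard imsetS //=.
rewrite (card_orbit_regular _ regG (pHall_sub sylP)) dvdn_leq //.
by rewrite (card_Hall sylP) card_regular // -cardsT orbQ.
Qed.

Hypotheses (regC : regular_perm C) (cycC : cyclic C) (nGC : C \subset 'N(G)).
Hypotheses (nsPG : P <| G) (logn_le2 : (logn p #|P| <= 2)%N).

Lemma regular_abelem_Sylow_cyclic : odd p -> p.-abelem P -> cyclic P.
Proof.
move=> odd_p abelP; rewrite (abelem_cyclic abelP).
have [T sylT] := Sylow_exists p C; have sTC := pHall_sub sylT.
have /cyclicP[t defT] := cyclicS sTC cycC.
have Tt : t \in T by rewrite defT cycle_id.
have -> : #|P| = #[t].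
  by rewrite orderE -defT (card_Hall sylT) (card_Hall sylP) !card_regular.
have nPT : T \subset 'N(P).
  rewrite (char_norm_trans _ (subset_trans sTC nGC)) //.
  by rewrite -(normal_Hall_pcore sylP) ?pcore_char.
pose Q := (P <*> T)%G.
have pQ : p.-group Q.
  by rewrite /= norm_joinEr // pgroupM (pHall_pgroup sylP) (pHall_pgroup sylT).
have nsPQ : P <| Q by rewrite /= normalYl.
have Qt : t \in Q by rewrite mem_gen // inE Tt orbT.
have [x orbQ] := regular_Sylow_orbit pQ (normal_sub nsPQ).
have [u Pu ux] : exists2 u, u \in P & u x = t x.
  have /orbitP[u Pu <-] : t x \in orbit 'P P x; last by exists u.
  by rewrite -orbQ; exact: (mem_orbit 'P x Qt).
have Qw : t * u^-1 \in Q.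
  by rewrite groupM ?groupV // (subsetP (normal_sub nsPQ)).
have tp : t ^+ p = (t * u^-1) ^+ p.
  rewrite -(expMg_abelem_rank2 p_pr odd_p pQ nsPQ abelP logn_le2 Qw Pu).
  by rewrite mulgKV.
suff /(dvdn_leq_log p (prime_gt0 p_pr)) : #[t] %| p.
  by rewrite (logn_prime p p_pr) eqxx.
rewrite order_dvdn; apply/eqP; apply: (regular_fix1 regC (x := x)).
  by rewrite groupX // (subsetP sTC).
by rewrite tp permX_fix // permM -ux permK.
Qed.

Lemma regular_Sylow_cyclic : ~~ (4 %| #|P|) -> cyclic P.
Proof.
move=> ndvd4; have oP := card_pgroup (pHall_pgroup sylP).
have [le1 | gt1] := leqP (logn p #|P|) 1.
  case: (logn p #|P|) le1 oP => [|[|//]] _ oP.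
    by rewrite (card1_trivg oP) cyclic1.
  by apply: prime_cyclic; rewrite oP.
have eq2 : logn p #|P| = 2 by apply/eqP; rewrite eqn_leq logn_le2.
rewrite eq2 in oP; apply: contraT => ncycP.
have abelP := noncyclic_card_p2_abelem p_pr oP ncycP.
case: (even_prime p_pr) => [p2 | odd_p]; first by rewrite oP p2 in ndvd4.
by rewrite regular_abelem_Sylow_cyclic in ncycP.
Qed.

End CyclicSylow.

Lemma regular_cyclic_norm_cyclic (gT : finGroupType) (G C : {group {perm gT}}) :
    regular_perm G -> regular_perm C -> cyclic C -> C \subset 'N(G) ->
    abelian G -> (forall p, logn p #|G| <= 2)%N -> ~~ (4 %| #|G|) ->
  cyclic G.
Proof.
move=> regG regC cycC nGC abelG le2 ndvd4.
apply: nil_Zgroup_cyclic (abelian_nil abelG).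
apply/forall_inP => P /SylowP[p p_pr sylP]; have sPG := pHall_sub sylP.
apply: (regular_Sylow_cyclic p_pr regG sylP regC) => //.
- by rewrite -sub_abelian_normal.
- by rewrite (card_Hall sylP) logn_part.
- by apply: contra ndvd4 => /dvdn_trans; apply; apply: cardSg.
Qed.

Section TwistedCycle.

Variables (gT : finGroupType) (g w : {perm gT}) (x : gT) (d : nat).
Hypotheses (reg_g : regular_perm <[g]>) (wx : w x = x).
Hypothesis gw : g ^ w = g ^+ (1 + d).
Local Notation n := #|gT|.
Local Notation t := (w * g).

Let order_g : #[g] = n := card_regular reg_g.

Lemma twisted_cycleJ : t ^ g^-1 = t * g ^+ d.
Proof.
by rewrite conjgE invgK !mulgA mulgK -mulgA -expgS -add1n -gw -conjgC.
Qed.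

(* On g-logarithms t acts as j |-> (1 + d) j + 1. If d were invertible modulo
   p, this map would fix a residue modulo p, hence a <g^p>-orbit. *)
Lemma regular_twist_dvd p : regular_perm <[t]> -> p \in primes n -> p %| d.
Proof.
rewrite mem_primes => reg_t /and3P[p_pr _ dvd_pn]; apply: contraT => ndvd_pd.
have co_dp : coprime d p by rewrite coprime_sym prime_coprime.
have [j _] := Bezoutr d (prime_gt0 p_pr).
rewrite (eqP co_dp) => /dvdnP[k def_k].
have nHw : w \in 'N(<[g ^+ p]>).
  apply/normP/eqP; rewrite eqEcard cardJg leqnn andbT -cycleJ conjXg gw.
  by rewrite expgAC cycleX.
have nHt : t \in 'N(<[g ^+ p]>).
  rewrite groupM // (subsetP (cent_sub _)) // cent_cycle.
  exact/cent1P/commuteX.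
have t_gj : g ^+ j * t = w * g ^+ (j + (1 + j * d)).
  rewrite mulgA (conjgC _ w) conjXg gw -expgM -mulgA -expgSr mulnDl mul1n.
  by rewrite mulnC addnS.
have orb_t : t ((g ^+ j) x) \in orbit 'P <[g ^+ p]> ((g ^+ j) x).
  apply/orbitP; exists ((g ^+ p) ^+ k); first exact: mem_cycle.
  rewrite /= apermE -expgM -!permM -expgD [(p * k)%N]mulnC -def_k t_gj.
  by rewrite permM wx.
have : <[g ^+ p]> = <[g]>.
  by apply: (regular_norm_sub_eq reg_g reg_t _ nHt orb_t); rewrite cycleX.
move/(congr1 (fun A : {set _} => #|A|))/eqP.
rewrite -!orderE orderXdiv order_g // ltn_eqF //.
by rewrite ltn_Pdiv ?prime_gt1 // -order_g order_gt0.
Qed.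

Hypotheses (dvd_d2 : n %| d ^ 2) (odd_or_dvd : odd n \/ n %| d).

Let comm_gw : [~ g, w] = g ^+ d.
Proof. by rewrite commgEl gw add1n expgS mulKg. Qed.

Lemma commute_twist : commute w [~ g, w].
Proof.
rewrite comm_gw; apply/commute_sym/commgP/conjg_fixP; rewrite conjXg gw -expgM.
apply/eqP; rewrite mulnDl mul1n mulnn eq_expg_mod_order order_g.
by rewrite -modnDmr (eqP dvd_d2) addn0.
Qed.

Lemma twistX_eq1 i : n %| d * i -> w ^+ i = 1.
Proof.
move=> dvd_di; apply: (regular_cent_fix1 (x := x) reg_g); last exact: permX_fix.
rewrite cent_cycle; apply/cent1P/commute_sym/commgP.
by rewrite (commgX i commute_twist) comm_gw -expgM -order_dvdn order_g.
Qed.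

Lemma twisted_cycleX m : t ^+ m = w ^+ m * g ^+ (m + d * 'C(m, 2)).
Proof.
have commute_g : commute g [~ g, w] by rewrite comm_gw; apply: commuteX.
by rewrite (expMg_Rmul m commute_g commute_twist) comm_gw expgD expgM mulgA.
Qed.

Lemma twisted_cycleX_fix m : (t ^+ m) x = x -> n %| m.
Proof.
rewrite twisted_cycleX permM (permX_fix _ wx) => gx.
rewrite -(dvdn_addn_mul_bin2 dvd_d2 odd_or_dvd) -order_g order_dvdn; apply/eqP.
by apply: (regular_fix1 reg_g) gx; rewrite mem_cycle.
Qed.

Lemma regular_twisted_cycle : regular_perm <[t]>.
Proof.
have tn : t ^+ n = 1.
  rewrite twisted_cycleX twistX_eq1 ?dvdn_mull // mul1g; apply/eqP.
  by rewrite -order_dvdn order_g dvdn_addn_mul_bin2.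
apply: (card_fix1_regular (x := x)) => [|_ /cycleP[i ->]].
  apply/eqP; rewrite eqn_dvd -orderE order_dvdn tn eqxx.
  by apply: twisted_cycleX_fix; rewrite expg_order perm1.
by case/twisted_cycleX_fix/dvdnP=> k ->; rewrite mulnC expgM tn expg1n.
Qed.

Lemma twisted_cycle_expg : t ^+ d = g ^+ d.
Proof.
rewrite twisted_cycleX twistX_eq1 ?mulnn // mul1g; apply/eqP.
rewrite eq_expg_mod_order order_g -modnDmr.
by rewrite (eqP (dvdn_mul_bin2 dvd_d2 odd_or_dvd)) addn0.
Qed.

Lemma twisted_cycleJ_expg : t ^ g^-1 = t ^+ (1 + d).
Proof. by rewrite twisted_cycleJ -twisted_cycle_expg -expgS. Qed.

Lemma norm_twisted_cycle : g \in 'N(<[t]>).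
Proof.
rewrite -groupV; apply/normP/eqP; rewrite eqEcard cardJg leqnn andbT.
by rewrite -cycleJ twisted_cycleJ_expg cycleX.
Qed.

Lemma twisted_cycle_dual : t ^ (g^-1 * t) = t ^+ (1 + d).
Proof. by rewrite conjgM twisted_cycleJ_expg conjXg conjgE mulKg. Qed.

End TwistedCycle.

Section CyclicHGS.

Variables (gT : finGroupType) (gamma : gT).
Hypothesis defT : [set: gT] = <[gamma]>.
Implicit Types (G : {group {perm gT}}) (w : {perm gT}).
Local Notation n := #|gT|.
Local Notation s := (lambda_perm gamma).

Lemma lambda_permX i : s ^+ i = lambda_perm (gamma ^+ i).
Proof.
elim: i => [|i IHi]; apply/permP => y; first by rewrite perm1 permE mul1g.
by rewrite expgSr permM IHi !permE mulgA -expgS.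
Qed.

Lemma lambda_img_cycle : lambda_img gT = <[s]>.
Proof.
apply/setP => g; apply/imsetP/cycleP => [[y _ ->] | [i ->]].
  have /cycleP[i ->] : y \in <[gamma]> by rewrite -defT inE.
  by exists i; rewrite lambda_permX.
by exists (gamma ^+ i); rewrite ?lambda_permX.
Qed.

Lemma order_lambda_perm : #[s] = n.
Proof.
rewrite orderE -lambda_img_cycle card_imset // => a b.
by move/(congr1 (fun g : {perm gT} => g 1)); rewrite !permE !mulg1.
Qed.

Lemma regular_lambda : regular_perm <[s]>.
Proof.
apply: (card_fix1_regular (x := 1)) => [|_ /cycleP[i ->]].
  exact: order_lambda_perm.
rewrite lambda_permX permE mulg1 => ->.
by apply/permP => y; rewrite permE mul1g perm1.
Qed.

Lemma HGSE G : (G \in HGS gT) = regular_perm G && (s \in 'N(G)).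
Proof. by rewrite inE lambda_img_cycle cycle_subG. Qed.

Lemma expg_inj a : coprime n a -> injective (fun y : gT => y ^+ a).
Proof.
by rewrite -cardsT => co_na y z; apply: (can_in_inj (expgK co_na)); rewrite inE.
Qed.

Definition expg_perm a (co_na : coprime n a) : {perm gT} :=
  perm (expg_inj co_na).

Lemma lambda_expg_perm a (co_na : coprime n a) : s ^ expg_perm co_na = s ^+ a.
Proof.
apply: (mulgI (expg_perm co_na)); rewrite -conjgC lambda_permX.
apply/permP => y; rewrite !permM !permE expgMn //.
by apply: (centsP (cycle_abelian gamma)); rewrite -defT inE.
Qed.

Hypotheses (dvd_rad2 : n %| rad n ^ 2) (odd_or_rad : odd n \/ rad n = n).

Let n_gt0 : (0 < n)%N. Proof. by rewrite -order_lambda_perm. Qed.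

Let rad_gt0 : (0 < rad n)%N. Proof. by rewrite (dvdn_gt0 n_gt0) ?rad_dvdn. Qed.

Let dvd_sqr d : rad n %| d -> n %| d ^ 2.
Proof. by move=> rad_d; rewrite (dvdn_trans dvd_rad2) ?dvdn_exp2r. Qed.

Let odd_or_dvd d : rad n %| d -> odd n \/ n %| d.
Proof. by move=> rad_d; case: odd_or_rad => [|<-]; [left | right]. Qed.

Lemma cyclic_HGS_twist G :
    cyclic G -> G \in HGS gT ->
  exists w d, [/\ G :=: <[w * s]>, w 1 = 1, rad n %| d & s ^ w = s ^+ (1 + d)].
Proof.
move=> cycG; rewrite HGSE => /andP[regG nGs].
have [h Gh h1] := regular_trans 1 (s 1) regG.
have sHG : <[h]> \subset G by rewrite cycle_subG.
have nHs : s \in 'N(<[h]>).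
  rewrite -cycle_subG (char_norm_trans (G := G)) ?cycle_subG //.
  by rewrite sub_cyclic_char.
have defG : <[h]> = G.
  apply: (regular_norm_sub_eq (y := 1) regG regular_lambda) => //.
  by rewrite -h1; apply: (mem_orbit 'P 1 (cycle_id h)).
have /cycleP[d hd] : [~ h, s^-1] \in <[h]>.
  by rewrite commgEl groupMl ?groupV ?cycle_id // memJ_norm ?groupV ?cycle_id.
(* s^-1 is itself a twist, based at s 1, of the cycle h^-1. *)
pose v := s^-1 * h; have sV : v * h^-1 = s^-1 by rewrite mulgK.
have vs1 : v (s 1) = s 1 by rewrite permM permK h1.
have hv : h^-1 ^ v = h^-1 ^+ (1 + d).
  rewrite conjgM !conjVg expgVn; congr _^-1.
  by rewrite (conjg_mulR h s^-1) hd -expgS conjXg conjgE mulKg.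
have regV : regular_perm <[h^-1]> by rewrite cycleV defG.
have rad_d : rad n %| d.
  apply: rad_dvd => p; apply: (regular_twist_dvd regV vs1 hv).
  by rewrite sV cycleV; exact: regular_lambda.
exists (h * s^-1), d; split=> //; first by rewrite mulgKV.
  by rewrite permM h1 permK.
have := twisted_cycle_dual regV vs1 hv (dvd_sqr rad_d) (odd_or_dvd rad_d).
by rewrite sV invgK conjVg expgVn => /invg_inj.
Qed.

Lemma coprime_1D d : rad n %| d -> coprime n (1 + d).
Proof.
by move=> rad_d; rewrite -(mul1n d) coprime_addn_mul ?coprimen1 ?dvd_sqr.
Qed.

Let rad_dvd_mull c : rad n %| c * rad n := dvdn_mull c (dvdnn (rad n)).

Definition radical_twist c : {perm gT} :=
  expg_perm (coprime_1D (rad_dvd_mull c)).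

Lemma radical_twist1 c : radical_twist c 1 = 1.
Proof. by rewrite permE expg1n. Qed.

Lemma lambda_radical_twist c : s ^ radical_twist c = s ^+ (1 + c * rad n).
Proof. exact: lambda_expg_perm. Qed.

Definition twisted_HGS (c : 'I_(n %/ rad n)) : {group {perm gT}} :=
  <[radical_twist c * s]>%G.

Lemma twisted_HGS_mem c : twisted_HGS c \in HGS gT.
Proof.
have [dvd2 odd_or] := (dvd_sqr (rad_dvd_mull c), odd_or_dvd (rad_dvd_mull c)).
have [w1 sw] := (radical_twist1 c, lambda_radical_twist c).
rewrite HGSE (regular_twisted_cycle regular_lambda w1 sw) //.
exact: norm_twisted_cycle regular_lambda w1 sw _ _.
Qed.

Lemma twisted_HGS_inj : injective twisted_HGS.
Proof.
move=> c c' eqG; have := twisted_HGS_mem c'; rewrite HGSE => /andP[regG _].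
have ws_c' : radical_twist c' * s \in twisted_HGS c' by exact: cycle_id.
have ws_c : radical_twist c * s \in twisted_HGS c' by rewrite -eqG cycle_id.
have /mulIg eq_w : radical_twist c * s = radical_twist c' * s.
  apply: (regular_inj (x := 1) regG ws_c ws_c').
  by rewrite !permM !radical_twist1.
have := congr1 (conjg s) eq_w; rewrite !lambda_radical_twist => /eqP.
rewrite eq_expg_mod_order order_lambda_perm eqn_modDl.
have lt_n (b : 'I_(n %/ rad n)) : (b * rad n < n)%N.
  by rewrite -ltn_divRL ?rad_dvdn.
by rewrite !modn_small // eqn_pmul2r // => /eqP/val_inj.
Qed.

Lemma cyclic_HGS_twisted G :
  cyclic G -> G \in HGS gT -> exists c, G = twisted_HGS c.
Proof.
move=> cycG HG; have [w [d [defG w1 rad_d sw]]] := cyclic_HGS_twist cycG HG.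
have lt_c : (d %% n %/ rad n < n %/ rad n)%N.
  by rewrite ltn_divLR // divnK ?ltn_mod ?rad_dvdn.
exists (Ordinal lt_c); apply: val_inj; rewrite /= defG.
suff -> : w = radical_twist (d %% n %/ rad n) by [].
apply: (regular_cycle_conj_inj regular_lambda w1 (radical_twist1 _)).
rewrite sw lambda_radical_twist; apply/eqP.
rewrite eq_expg_mod_order order_lambda_perm eqn_modDl divnK ?modn_mod //.
by rewrite /dvdn modn_dvdm ?rad_dvdn.
Qed.

Lemma card_cyclic_HGS : #|[set G in HGS gT | cyclic G]| = (n %/ rad n)%N.
Proof.
rewrite -[RHS]card_ord -(card_imset _ twisted_HGS_inj); apply: eq_card => G.
rewrite inE; apply/andP/imsetP => [[HG cycG] | [c _ ->]].
  by have [c ->] := cyclic_HGS_twisted cycG HG; exists c.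
by rewrite twisted_HGS_mem cycle_cyclic.
Qed.

End CyclicHGS.

Theorem theorem4 (gT : finGroupType) (n : nat) :
  0 < n ->
  (forall p, p \in primes n -> logn p n <= 2) ->
  (forall p q, p \in primes n -> q \in primes n -> ~~ (p %| q ^ logn q n - 1)) ->
  ~~ (4 %| n) ->
  cyclic [set: gT] -> #|gT| = n ->
  #|HGS gT| = n %/ rad n /\ (forall G : {group {perm gT}}, G \in HGS gT -> cyclic G).
Proof.
move=> n_gt0 le2 ndvd ndvd4 /cyclicP[gamma defT] oT.
have {}le2 p : (logn p n <= 2)%N.
  by have [->//|] := posnP (logn p n); rewrite logn_gt0; apply: le2.
have HGS_cyclic (G : {group {perm gT}}) : G \in HGS gT -> cyclic G.
  rewrite (HGSE defT) -cycle_subG => /andP[regG nGs].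
  have oG : #|G| = n by rewrite card_regular.
  apply: (regular_cyclic_norm_cyclic regG (regular_lambda defT)).
  all: rewrite ?oG ?cycle_cyclic //.
  by apply: abelian_of_order; rewrite oG.
split=> //; subst n.
have dvd_rad2 := dvdn_rad_sqr le2 n_gt0.
have odd_or_rad := odd_or_rad_id ndvd ndvd4 n_gt0.
rewrite -(card_cyclic_HGS defT dvd_rad2 odd_or_rad); apply: eq_card => G.
by rewrite [RHS]inE; apply/idP/andP => [HG | []//]; split; rewrite ?HGS_cyclic.
Qed.
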